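(* Problem PCDMAS (as defined in the context, for the data $A,B,C,\mathcal{G}$) is solvable if and only if there exist matrices $K\in\mathbb{R}^{m\times r}$ and $L\in\mathbb{R}^{r\times p}$ such that all of the following conditions hold: 1) $BK\succeq 0$; 2) $A-BK$ is Metzler and Hurwitz; 3) $LC\succeq 0$; 4) $A-l_{\max}LC$ is Metzler; 5) $A-\lambda_i LC$ is Hurwitz for every $i\in\{2,\dots,n\}$.
   Context: Notation. For a real matrix or vector $M$, $M\succeq 0$ means all entries are non-negative. A real square matrix is Metzler if all its off-diagonal entries are non-negative. A (real or complex) square matrix is Hurwitz if all its eigenvalues have strictly negative real part. Graph. $\mathcal{G}=(\mathcal{V},\mathcal{E})$ is a directed graph with vertices $v_1,\dots,v_n$, $n\ge 2$, without self-loops, which has a spanning tree, i.e. there is a node from which there is a directed path to every other node. Its adjacency matrix $\mathcal{A}\in\mathbb{R}^{n\times n}$ has $[\mathcal{A}]_{ij}=1$ if $(v_j,v_i)\in\mathcal{E}$ (a directed edge from $v_j$ to $v_i$) and $[\mathcal{A}]_{ij}=0$ otherwise. The Laplacian $\mathcal{L}$ is defined by $[\mathcal{L}]_{ii}=\sum_{j}[\mathcal{A}]_{ij}$ and $[\mathcal{L}]_{ij}=-[\mathcal{A}]_{ij}$ for $i\ne j$. Put $l_{\max}=\max_i[\mathcal{L}]_{ii}$. The eigenvalues of $\mathcal{L}$ (with multiplicity, possibly complex) are ordered as $0=\lambda_1<\mathrm{Re}(\lambda_2)\le\dots\le\mathrm{Re}(\lambda_n)$. Agents. $A\in\mathbb{R}^{r\times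 r}$ is Metzler, $B\in\mathbb{R}^{r\times m}$ and $C\in\mathbb{R}^{p\times r}$ satisfy $B\succeq 0$, $C\succeq 0$, and $(A,B,C)$ is stabilizable and detectable. For $i=1,\dots,n$, agent $i$ has dynamics $\dot x_i=Ax_i+Bu_i$, $y_i=Cx_i$, and uses the observer-type dynamic output-feedback protocol $\dot{\hat x}_i=A\hat x_i+LC\sum_{j}[\mathcal{A}]_{ij}(e_i-e_j)+Bu_i$, $u_i=-K\hat x_i$, where $e_i:=x_i-\hat x_i$ and $K\in\mathbb{R}^{m\times r}$, $L\in\mathbb{R}^{r\times p}$ are gain matrices to be designed. With $\tilde x_i=[x_i^{\mathrm T},e_i^{\mathrm T}]^{\mathrm T}\in\mathbb{R}^{2r}$ the augmented closed-loop system is $$\dot{\tilde x}_i=\tilde A\tilde x_i+\tilde B L\tilde C\sum_{j=1}^n[\mathcal{A}]_{ij}(\tilde x_j-\tilde x_i),\quad i=1,\dots,n,$$ $$\tilde A=\begin{bmatrix}A-BK&BK\\ 0&A\end{bmatrix},\quad \tilde B=\begin{bmatrix}0\\ I\end{bmatrix},\quad \tilde C=\begin{bmatrix}0&C\end{bmatrix}.$$ Problem PCDMAS (Positive Consensus of Directed Multi-agent Systems). Design $K$ and $L$ such that for all non-negative initial values ($\tilde x_i(0)\succeq0$ for all $i$), the solution of the augmented closed-loop system satisfies $\lim_{t\to\infty}(\tilde x_j(t)-\tilde x_i(t))=0$ for all $i,j\in\{1,\dots,n\}$, and $\tilde x_i(t)\succeq 0$ for all $t\ge0$ and all $i$. The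 problem is solvable if such $K,L$ exist. *)

(* Defs.v *)
From HB Require Import structures.
From mathcomp Require Import all_boot all_order all_algebra.
From mathcomp Require Import all_classical all_reals all_analysis.
From mathcomp Require Import complex.

Set Implicit Arguments.
Unset Strict Implicit.
Unset Printing Implicit Defensive.

Import Order.TTheory GRing.Theory Num.Theory.
Import numFieldNormedType.Exports.

Local Open Scope classical_set_scope.
Local Open Scope ring_scope.

Definition nonneg_mx (R : realType) (k l : nat) (M : 'M[R]_(k, l)) : Prop :=
  forall i j, 0 <= M i j.

Definition metzler (R : realType) (k : nat) (M : 'M[R]_k) : Prop :=
  forall i j, i != j -> 0 <= M i j.

Definition complex_mx (R : realType) (k l : nat) (M : 'M[R]_(k, l)) :
  'M[R[i]]_(k, l) := map_mx (real_complex R) M.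

(* [eigenvalue] refers to row vectors, [v *m M = z *: v]; the spectrum of a
   square matrix is the same for row and for column vectors. *)
Definition hurwitzC (R : realType) (k : nat) (M : 'M[R[i]]_k) : Prop :=
  forall z : R[i], eigenvalue M z -> complex.Re z < 0.

Definition hurwitz (R : realType) (k : nat) (M : 'M[R]_k) : Prop :=
  hurwitzC (complex_mx M).

Definition stabilizable (R : realType) (r m : nat)
    (A : 'M[R]_r) (B : 'M[R]_(r, m)) : Prop :=
  exists K : 'M[R]_(m, r), hurwitz (A - B *m K).

Definition detectable (R : realType) (r p : nat)
    (A : 'M[R]_r) (C : 'M[R]_(p, r)) : Prop :=
  exists L : 'M[R]_(r, p), hurwitz (A - L *m C).

(* [E j i] means that there is a directed edge from vertex [j] to vertex [i]. *)
Definition has_spanning_tree (n : nat) (E : rel 'I_n) : Prop :=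
  exists root : 'I_n, forall v : 'I_n, connect E root v.

(* Row [i] of the adjacency matrix records the edges entering [i]. *)
Definition adjacency (R : realType) (n : nat) (E : rel 'I_n) : 'M[R]_n :=
  \matrix_(i, j) (E j i)%:R.

Definition laplacian (R : realType) (n : nat) (E : rel 'I_n) : 'M[R]_n :=
  \matrix_(i, j) (if i == j then \sum_(k < n) adjacency R E i k
                  else - adjacency R E i j).

(* The diagonal of the Laplacian is non-negative, so starting the maximum from
   [0] does not change it. *)
Definition lmax (R : realType) (n : nat) (E : rel 'I_n) : R :=
  \big[Num.max/0]_(i < n) laplacian R E i i.

(* [lam] lists the eigenvalues of the Laplacian with multiplicity, from the
   eigenvalue [0], in order of non-decreasing real part; index [0 : 'I_n]
   carries the first eigenvalue. When the graph has a spanning tree, the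
   eigenvalue [0] is simple and all others have positive real part, so the
   inequality [Re (lam 0) < Re (lam 1)] then holds automatically. *)
Definition laplacian_spectrum (R : realType) (n : nat) (E : rel 'I_n)
    (lam : 'I_n -> R[i]) : Prop :=
  [/\ char_poly (complex_mx (laplacian R E)) = \prod_(i < n) ('X - (lam i)%:P),
      forall i : 'I_n, i = 0%N :> nat -> lam i = 0
    & forall i j : 'I_n, (i <= j)%N -> complex.Re (lam i) <= complex.Re (lam j)].

Definition tildeA (R : realType) (r m : nat)
    (A : 'M[R]_r) (B : 'M[R]_(r, m)) (K : 'M[R]_(m, r)) : 'M[R]_(r + r) :=
  block_mx (A - B *m K) (B *m K) 0 A.

Definition tildeB (R : realType) (r : nat) : 'M[R]_(r + r, r) :=
  col_mx 0 1%:M.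

Definition tildeC (R : realType) (r p : nat) (C : 'M[R]_(p, r)) :
  'M[R]_(p, r + r) := row_mx 0 C.

(* Solutions on [0, +oo[ : continuous from the right at [0] and satisfying the
   differential equation at all positive times. The first [r] coordinates of
   [x i t] are the state of agent [i], the last [r] its observer error. *)
Definition closed_loop_solution (R : realType) (n r m p : nat) (E : rel 'I_n)
    (A : 'M[R]_r) (B : 'M[R]_(r, m)) (C : 'M[R]_(p, r))
    (K : 'M[R]_(m, r)) (L : 'M[R]_(r, p))
    (x : 'I_n -> R -> 'cV[R]_(r + r)) : Prop :=
  forall i : 'I_n,
    x i t @[t --> 0^'+] --> x i 0 /\
    forall t : R, 0 < t ->
      is_derive t (1 : R) (x i)
        (tildeA A B K *m x i t +
         tildeB R r *m L *m tildeC C *m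
           (\sum_(j < n) adjacency R E i j *: (x j t - x i t))).

Definition PCDMAS_solvable (R : realType) (n r m p : nat) (E : rel 'I_n)
    (A : 'M[R]_r) (B : 'M[R]_(r, m)) (C : 'M[R]_(p, r)) : Prop :=
  exists (K : 'M[R]_(m, r)) (L : 'M[R]_(r, p)),
    forall x : 'I_n -> R -> 'cV[R]_(r + r),
      closed_loop_solution E A B C K L x ->
      (forall i, nonneg_mx (x i 0)) ->
      (forall i j, x j t - x i t @[t --> +oo%R] --> (0 : 'cV[R]_(r + r))) /\
      (forall (t : R) (i : 'I_n), 0 <= t -> nonneg_mx (x i t)).

(* Main.v *)
Require Import Defs.
From mathcomp Require Import all_boot all_order all_algebra.
From mathcomp Require Import all_classical all_reals all_analysis.
From mathcomp Require Import complex ring lra.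

Import Order.TTheory GRing.Theory Num.Theory.
Import numFieldNormedType.Exports.
Local Open Scope ring_scope.
Local Open Scope classical_set_scope.

Set Implicit Arguments.
Unset Strict Implicit.
Unset Printing Implicit Defensive.

(** The closed loop of all agents is one linear system [y' = M y] with
    [M = I (x) tildeA - L (x) (tildeB L tildeC)], and the two requirements on its
    solutions translate separately into conditions on [M].

    Positivity. Solutions from non-negative initial values stay non-negative iff
    [M] is Metzler ([metzler_solves_ge0], [flow_ge0_metzler]). Block by block,
    using that the graph has an edge, this says that [B K] and [L C] are
    non-negative and that [A - B K] and [A - l_i L C] are Metzler for every
    degree [l_i], equivalently for the largest one ([network_metzler],
    [network_metzler_design]).

    Sufficiency for consensus. The errors evolve by themselves; as rows of a
    matrix [F] they satisfy [F' = F A^T - L F (L C)^T] (the first [L] is the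
    Laplacian, the second the gain). Instead of triangularizing the Laplacian,
    [modal_reduction] multiplies [F] successively by the factors [L - lam i]:
    each partial product obeys an equation with the matrix [A - lam i L C],
    driven by the product with one factor more, and the full product over
    [i >= 1] has constant columns by Cayley-Hamilton and the maximum principle.
    Hence the differences of the errors vanish ([error_consensus]), and they in
    turn drive the differences of the states through the Hurwitz matrix
    [A - B K] ([state_consensus]). The same reduction with scalar blocks shows
    that Hurwitz matrices are stable under vanishing inputs
    ([hurwitz_stable]).

    Conversely, a left eigenvector of [M] that annihilates consensus states gives
    scalar modes [s' = z s] which must tend to [0]; not all of them start at [0],
    so [Re z < 0] ([mode_obstruction]). Eigenvectors of [A - B K] and of
    [A - lam i L C] provide such functionals ([state_feedback_hurwitz],
    [observer_hurwitz]). The second case needs [lam i] to be non-zero for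
    [i >= 1], that is, [0] to be an algebraically simple eigenvalue of the
    Laplacian ([laplacian_eigenvalue_neq0]), which rests on the spanning tree.
    Solutions to test are provided by the exponential series ([flow]). *)

(** * Real differential inequalities *)

Section RealCalculus.
Context {R : realType}.
Implicit Types (f u h : R -> R) (t : R).

Lemma is_derive_sum_fin (I : finType) (f : I -> R -> R) (d : I -> R) t :
  (forall i, is_derive t (1 : R) (f i) (d i)) ->
  is_derive t (1 : R) (fun s => \sum_i f i s) (\sum_i d i).
Proof.
move=> fd; have -> : (fun s => \sum_i f i s) = \sum_i f i.
  by apply/funext => s; rewrite fct_sumE.
apply: (big_ind2 (fun g dg => is_derive t (1 : R) g dg)) => //.
- exact: is_derive_cst.
- by move=> g1 d1 g2 d2 gd1 gd2; exact: is_deriveD.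
Qed.

Lemma cvg_sum_fin (T : Type) (F : set_system T) (FF : Filter F) (I : finType)
    (f : I -> T -> R) (l : I -> R) :
  (forall i, f i s @[s --> F] --> l i) ->
  \sum_i f i s @[s --> F] --> \sum_i l i.
Proof.
move=> fl; have -> : (fun s => \sum_i f i s) = \sum_i f i.
  by apply/funext => s; rewrite fct_sumE.
apply: (big_ind2 (fun (g : T -> R) (c : R) => g s @[s --> F] --> c)) => //.
- exact: cvg_cst.
- by move=> *; exact: cvgD.
Qed.

Lemma nonincreasing_of_derive u (du : R -> R) (a : R) :
  (forall t, a < t -> is_derive t (1 : R) u (du t)) ->
  (forall t, a < t -> du t <= 0) ->
  u t @[t --> a^'+] --> u a ->
  forall t, a <= t -> u t <= u a.
Proof.
move=> ud du0 ua t leat.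
apply: (@ler0_derive1_nincry _ u a) => //.
- by move=> x; rewrite in_itv/= andbT => /ud [].
- move=> x; rewrite in_itv/= andbT => ax; have := ud _ ax => uda.
  by rewrite derive1E derive_val; apply: du0.
- apply/continuous_within_itvcyP; split => // x; rewrite in_itv/= andbT => ax.
  by have [/derivable1_diffP/differentiable_continuous] := ud _ ax.
Qed.

Lemma is_derive_expR_affine (a T t : R) :
  is_derive t (1 : R) (fun s => expR (a * (s - T))) (a * expR (a * (t - T))).
Proof.
have h : is_derive t (1 : R) (fun s => a * (s - T)) a.
  have -> : (fun s => a * (s - T)) = a *: ((id : R -> R) - cst T).
    by apply/funext.
  by apply: is_derive_eq; rewrite subr0 /GRing.scale/= mulr1.
have := @is_derive1_comp _ expR (fun s => a * (s - T)) t _ _ _ h.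
by move=> /(_ _ (is_derive_expR _)); rewrite mulrC.
Qed.

(** A dissipative quantity with vanishing input vanishes: once [h] is below
    [a e / 2] the excess of [u] over [e / 2] decays like [exp (- a t)]. *)
Lemma gronwall_vanish u (du h : R -> R) (a : R) :
  0 < a -> (forall t, 0 <= u t) ->
  (forall t, 0 < t -> is_derive t (1 : R) u (du t)) ->
  (forall t, 0 < t -> du t <= - a * u t + h t) ->
  h t @[t --> +oo] --> (0 : R) ->
  u t @[t --> +oo] --> (0 : R).
Proof.
move=> a0 u0 ud duh h0; apply/cvgrPdist_lt => e e0.
have e2 : 0 < e / 2 by rewrite divr_gt0.
have ae : 0 < a * (e / 2) by rewrite mulr_gt0.
have [T [_ hT]] := (cvgrPdist_lt _ _).1 h0 _ ae.
(* The differential inequality holds at positive times only, so the time after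
   which [h] is small has to be positive as well. *)
pose T' := Num.max T 0 + 1.
have T'0 : 0 < T' by rewrite ltr_pwDr// le_max lexx orbT.
have hT' t : T' <= t -> h t <= a * (e / 2).
  move=> tt; apply: le_trans (ler_norm _) _.
  rewrite -normrN -sub0r; apply/ltW/hT.
  by apply: lt_le_trans tt; rewrite ltr_pwDr// le_max lexx.
(* From T' on, [h <= a e / 2], so [u - e / 2] is dominated by a multiple of
   [exp (- a t)]: the function [w] below does not increase. *)
pose w t := (u t - e / 2) * expR (a * (t - T')).
have wd t : 0 < t -> is_derive t (1 : R) w
    ((du t + a * u t - a * (e / 2)) * expR (a * (t - T'))).
  move=> tt; have udt := ud _ tt.
  have ex := is_derive_expR_affine a T' t.
  have -> : w = (u - cst (e / 2)) * (fun s => expR (a * (s - T'))).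
    by apply/funext.
  apply: is_derive_eq; rewrite /GRing.scale/= subr0 /cst/= -[(u - _) t]/(u t - e / 2).
  ring.
have wle t : T' <= t -> w t <= w T'.
  apply: (nonincreasing_of_derive (fun t tt => wd t (lt_trans T'0 tt))).
    move=> s Ts; rewrite mulr_le0_ge0 ?expR_ge0//.
    have := duh s (lt_trans T'0 Ts); have := hT' s (ltW Ts); lra.
  have [/derivable1_diffP/differentiable_continuous cw _] := wd _ T'0.
  by apply: cvg_within_filter; exact: cw.
(* At time [T' + b] the lower bound [1 + a b] for the exponential makes
   [e / 2 * expR (a b)] exceed [w T']. *)
pose b := 2 * u T' / (a * e) + 1.
exists (T' + b); split; first exact: num_real.
move=> t tt; rewrite sub0r normrN ger0_norm//.
have b0 : 0 < b.
  by rewrite ltr_wpDl// divr_ge0 ?mulr_ge0// ltW.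
have Tt : T' <= t by rewrite (le_trans _ (ltW tt))// lerDl ltW.
have := wle _ Tt; rewrite /w subrr mulr0 expR0 mulr1.
set E := expR _ => wE.
have E1 : 1 + a * (t - T') <= E by exact: expR_ge1Dx.
rewrite ltNge; apply/negP => eu.
have E0 : 0 < E by exact: expR_gt0.
have h1 : e / 2 * E <= u T' - e / 2.
  apply: le_trans wE; rewrite ler_pM2r//; lra.
have h2 : e / 2 * (1 + a * (t - T')) <= u T' - e / 2.
  by apply: le_trans h1; rewrite ler_pM2l.
have h3 : e / 2 * (a * b) <= e / 2 * (a * (t - T')).
  by rewrite !ler_pM2l//; lra.
have h4 : e / 2 * (a * b) = u T' + e / 2 * a.
  rewrite /b; field; lra.
have := mulr_gt0 e2 a0; lra.
Qed.
End RealCalculus.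

(** * Complex-valued functions of time *)

Section ComplexFunctions.
Context {R : realType}.
Implicit Types (f g : R -> R[i]) (t : R) (z d : R[i]).

(** [R[i]] is handled as a pair of real coordinates: only differentiation along
    the real time axis is needed, and every use reduces to real functions. *)
Definition cderiv f t d :=
  is_derive t (1 : R) (fun s => complex.Re (f s)) (complex.Re d) /\
  is_derive t (1 : R) (fun s => complex.Im (f s)) (complex.Im d).

Definition cvanish f :=
  (complex.Re (f t) @[t --> +oo] --> (0 : R)) /\
  (complex.Im (f t) @[t --> +oo] --> (0 : R)).

Definition sqmod z : R := complex.Re z ^+ 2 + complex.Im z ^+ 2.

Let ReMz z d : complex.Re (z * d) =
  complex.Re z * complex.Re d - complex.Im z * complex.Im d.
Proof. by case: z d => [a b] [a' b']. Qed.

Let ImMz z d : complex.Im (z * d) =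
  complex.Re z * complex.Im d + complex.Im z * complex.Re d.
Proof. by case: z d => [a b] [a' b']. Qed.

Lemma cderiv_lincomb (I : finType) (c : I -> R[i]) (f : I -> R -> R[i])
    (d : I -> R[i]) t :
  (forall k, cderiv (f k) t (d k)) ->
  cderiv (fun s => \sum_k c k * f k s) t (\sum_k c k * d k).
Proof.
move=> fd; split.
- have -> : (fun s => complex.Re (\sum_k c k * f k s)) =
    (fun s => \sum_k (complex.Re (c k) * complex.Re (f k s) -
                      complex.Im (c k) * complex.Im (f k s))).
    by apply/funext => s; rewrite raddf_sum; apply: eq_bigr => k _; exact: ReMz.
  rewrite raddf_sum.
  apply: is_derive_sum_fin => k; rewrite /= ReMz; have [dr di] := fd k.
  exact: (is_deriveB (is_deriveZ _ dr) (is_deriveZ _ di)).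
- have -> : (fun s => complex.Im (\sum_k c k * f k s)) =
    (fun s => \sum_k (complex.Re (c k) * complex.Im (f k s) +
                      complex.Im (c k) * complex.Re (f k s))).
    by apply/funext => s; rewrite raddf_sum; apply: eq_bigr => k _; exact: ImMz.
  rewrite raddf_sum.
  apply: is_derive_sum_fin => k; rewrite /= ImMz; have [dr di] := fd k.
  exact: (is_deriveD (is_deriveZ _ di) (is_deriveZ _ dr)).
Qed.

Lemma cvanishD f g : cvanish f -> cvanish g -> cvanish (fun t => f t + g t).
Proof.
move=> [fr fi] [gr gi]; split.
- have -> : (fun t => complex.Re (f t + g t)) =
    (fun t => complex.Re (f t) + complex.Re (g t)).
    by apply/funext => t; rewrite raddfD.
  by rewrite -[0 : R]addr0; exact: cvgD.
- have -> : (fun t => complex.Im (f t + g t)) =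
    (fun t => complex.Im (f t) + complex.Im (g t)).
    by apply/funext => t; rewrite raddfD.
  by rewrite -[0 : R]addr0; exact: cvgD.
Qed.

Lemma cvanishMl z f : cvanish f -> cvanish (fun t => z * f t).
Proof.
move=> [fr fi]; split.
- have -> : (fun t => complex.Re (z * f t)) =
    (fun t => complex.Re z * complex.Re (f t) - complex.Im z * complex.Im (f t)).
    by apply/funext => t; rewrite ReMz.
  have -> : (0 : R) = complex.Re z * 0 - complex.Im z * 0 by rewrite !mulr0 subr0.
  by apply: cvgB; apply: cvgZr.
- have -> : (fun t => complex.Im (z * f t)) =
    (fun t => complex.Re z * complex.Im (f t) + complex.Im z * complex.Re (f t)).
    by apply/funext => t; rewrite ImMz.
  have -> : (0 : R) = complex.Re z * 0 + complex.Im z * 0 by rewrite !mulr0 addr0.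
  by apply: cvgD; apply: cvgZr.
Qed.

Lemma cvanish_eventually0 f : (forall t, 0 < t -> f t = 0) -> cvanish f.
Proof.
move=> f0; split; apply/cvgrPdist_lt => e e0; exists 0; split => // t t0;
  by rewrite f0// subrr normr0.
Qed.

Lemma cvanish_lincomb (I : finType) (c : I -> R[i]) (f : I -> R -> R[i]) :
  (forall k, cvanish (f k)) -> cvanish (fun s => \sum_k c k * f k s).
Proof.
move=> f0; have -> : (fun s => \sum_k c k * f k s) =
    \sum_k (fun s => c k * f k s).
  by apply/funext => s; rewrite fct_sumE.
apply: big_ind => [|g h g0 h0|k _].
- exact: cvanish_eventually0.
- exact: cvanishD.
- exact: cvanishMl.
Qed.

Lemma sqmod_ge0 z : 0 <= sqmod z. Proof. by rewrite addr_ge0 ?sqr_ge0. Qed.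

Lemma sqmod_eq0 z : sqmod z <= 0 -> z = 0.
Proof.
case: z => [a b]; rewrite /sqmod/= => h.
have /eqP : a ^+ 2 + b ^+ 2 = 0 by apply/le_anti; rewrite h addr_ge0 ?sqr_ge0.
by rewrite paddr_eq0 ?sqr_ge0// !sqrf_eq0 => /andP[/eqP -> /eqP ->].
Qed.

Lemma sqmod_derive f t d : cderiv f t d ->
  is_derive t (1 : R) (fun s => sqmod (f s))
    (2 * (complex.Re (f t) * complex.Re d + complex.Im (f t) * complex.Im d)).
Proof.
move=> [fr fi].
have -> : (fun s => sqmod (f s)) =
    (fun s => complex.Re (f s)) ^+ 2 + (fun s => complex.Im (f s)) ^+ 2.
  by apply/funext.
apply: is_derive_eq; rewrite /GRing.scale/= !expr1; ring.
Qed.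

Lemma cvanish_sqmod f : cvanish f <-> sqmod (f t) @[t --> +oo] --> (0 : R).
Proof.
split=> [[fr fi]|h].
  have -> : (0 : R) = 0 * 0 + 0 * 0 by rewrite mulr0 addr0.
  by apply: cvgD; apply: cvgM.
have aux (p : R -> R) : (forall t, p t ^+ 2 <= sqmod (f t)) ->
    p t @[t --> +oo] --> (0 : R).
  move=> pf; apply/cvgrPdist_lt => e e0.
  have [T [Tr hT]] := (cvgrPdist_lt _ _).1 h _ (exprn_gt0 2 e0).
  exists T; split => // t /hT; rewrite !sub0r !normrN ger0_norm ?sqmod_ge0// => ut.
  rewrite -(ltr_pXn2r (n := 2))// ?nnegrE ?(ltW e0)// real_normK ?num_real//.
  exact: le_lt_trans (pf t) ut.
by split; apply: aux => t; rewrite /sqmod ?lerDl ?lerDr sqr_ge0.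
Qed.

(** The squared modulus [u] of [f] satisfies
    [u' <= Re z * u + sqmod g / - Re z], by completing the square in the cross
    term [2 Re (conj f * g)]; so it vanishes at infinity. *)
Lemma scalar_decay z f g :
  complex.Re z < 0 -> (forall t, 0 < t -> cderiv f t (z * f t + g t)) ->
  cvanish g -> cvanish f.
Proof.
move=> z0 fd /cvanish_sqmod g0; apply/cvanish_sqmod.
have a0 : 0 < - complex.Re z by rewrite oppr_gt0.
have ud t (t0 : 0 < t) := sqmod_derive (fd t t0).
apply: (gronwall_vanish (h := fun t => (- complex.Re z)^-1 * sqmod (g t)) a0
  _ ud) => [t|t t0|]; first exact: sqmod_ge0.
- rewrite !raddfD/= ReMz ImMz /sqmod.
  move: (complex.Re z) (complex.Im z) (complex.Re (f t)) (complex.Im (f t))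
    (complex.Re (g t)) (complex.Im (g t)) a0 => a b p q c d a0.
  rewrite -subr_ge0.
  have -> : - - a * (p ^+ 2 + q ^+ 2) + (- a)^-1 * (c ^+ 2 + d ^+ 2) -
     2 * (p * (a * p - b * q + c) + q * (a * q + b * p + d)) =
     (- a)^-1 * ((- a * p - c) ^+ 2 + (- a * q - d) ^+ 2).
    by field; lra.
  by rewrite mulr_ge0 ?invr_ge0 ?(ltW a0)// addr_ge0 ?sqr_ge0.
- by rewrite -[0 : R](mulr0 (- complex.Re z)^-1); apply: cvgZr.
Qed.

(** Along [f' = z f] with [0 <= Re z] the squared modulus does not decrease,
    so [f] can only vanish at infinity if it starts at [0]. *)
Lemma nondecaying_mode z f :
  0 <= complex.Re z -> (forall t, 0 < t -> cderiv f t (z * f t)) ->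
  complex.Re (f t) @[t --> 0^'+] --> complex.Re (f 0) ->
  complex.Im (f t) @[t --> 0^'+] --> complex.Im (f 0) ->
  cvanish f -> f 0 = 0.
Proof.
move=> z0 fd fr fi /cvanish_sqmod f0.
have le0 t : 0 <= t -> - sqmod (f t) <= - sqmod (f 0).
  have ud s (s0 : 0 < s) := is_deriveN (sqmod_derive (fd s s0)).
  apply: (nonincreasing_of_derive ud) => [s s0|].
    rewrite oppr_le0 ReMz ImMz.
    have -> : 2 * (complex.Re (f s) * (complex.Re z * complex.Re (f s) -
      complex.Im z * complex.Im (f s)) + complex.Im (f s) *
      (complex.Re z * complex.Im (f s) + complex.Im z * complex.Re (f s))) =
      2 * complex.Re z * sqmod (f s) by rewrite /sqmod; ring.
    by rewrite !mulr_ge0 ?sqmod_ge0.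
  by apply: cvgN; apply: cvgD; apply: cvgM.
apply/sqmod_eq0; rewrite leNgt; apply/negP => f0_gt0.
have [T [_ hT]] := (cvgrPdist_lt _ _).1 f0 _ f0_gt0.
pose t := Num.max T 0 + 1.
have t0 : 0 <= t by rewrite addr_ge0// le_max lexx orbT.
have /hT : T < t by rewrite ltr_pwDr// le_max lexx.
by rewrite sub0r normrN ger0_norm ?sqmod_ge0// ltNge -lerN2 le0.
Qed.

End ComplexFunctions.

(** * Modal reduction of linear networks *)

Section ModalReduction.
Context {R : realType}.
Local Notation C := R[i].

Definition mderiv k l (F : R -> 'M[C]_(k, l)) (t : R) (D : 'M[C]_(k, l)) :=
  forall i j, cderiv (fun s => F s i j) t (D i j).

Definition mvanish k l (F : R -> 'M[C]_(k, l)) :=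
  forall i j, cvanish (fun t => F t i j).

Lemma mderiv_mull k l n (A : 'M[C]_(n, k)) (F : R -> 'M[C]_(k, l)) t D :
  mderiv F t D -> mderiv (fun s => A *m F s) t (A *m D).
Proof.
move=> FD i j; under eq_fun do rewrite mxE; rewrite mxE.
by apply: cderiv_lincomb => k'.
Qed.

Lemma mderiv_eq k l (F : R -> 'M[C]_(k, l)) t D D' :
  mderiv F t D -> D = D' -> mderiv F t D'.
Proof. by move=> ? <-. Qed.

Lemma mvanish_mull k l n (A : 'M[C]_(n, k)) (F : R -> 'M[C]_(k, l)) :
  mvanish F -> mvanish (fun s => A *m F s).
Proof.
by move=> F0 i j; under eq_fun do rewrite mxE; apply: cvanish_lincomb.
Qed.

Lemma mvanish_mulr k l n (A : 'M[C]_(l, n)) (F : R -> 'M[C]_(k, l)) :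
  mvanish F -> mvanish (fun s => F s *m A).
Proof.
move=> F0 i j; under eq_fun do rewrite mxE.
under eq_fun do under eq_bigr do rewrite mulrC.
exact: cvanish_lincomb.
Qed.

Lemma mvanishD k l (F G : R -> 'M[C]_(k, l)) :
  mvanish F -> mvanish G -> mvanish (fun s => F s + G s).
Proof.
by move=> F0 G0 i j; under eq_fun do rewrite mxE; apply: cvanishD.
Qed.

(** Stability of [S] in an input-to-state form: a solution of [y' = y S + g]
    vanishes at infinity whenever its input [g] does. The input is part of the
    definition because the modes of a network drive one another in cascade. *)
Definition stable N (S : 'M[C]_N) := forall y g : R -> 'rV[C]_N,
  (forall t, 0 < t -> mderiv y t (y t *m S + g t)) -> mvanish g -> mvanish y.

(** Decoupling of a network [F' = F P + M F Q] whose rows are the agents, without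
    bringing [M] to triangular form. If [mu] is one of the listed numbers,
    [H := (M - mu) F] solves the same equation and has one factor less to
    annihilate, so by induction [D H] vanishes; and
    [D F' = D F (P + mu Q) + D H Q + D g], where the last two terms are a
    vanishing input to the stable matrix [P + mu Q]. With the eigenvalues of [M]
    as list, the product annihilates [M] by Cayley-Hamilton; the row [D] allows
    for a product that is only annihilated after composition with [D]. *)
Lemma modal_reduction n b (M : 'M[C]_n.+1) (P Q : 'M[C]_b) (D : 'rV[C]_n.+1)
    (s : seq C) (F g : R -> 'M[C]_(n.+1, b)) :
  (forall mu, mu \in s -> stable (P + mu *: Q)) ->
  (forall t, 0 < t -> mderiv F t (F t *m P + M *m F t *m Q + g t)) ->
  mvanish g ->
  (forall t, 0 < t ->
     D *m (horner_mx M (\prod_(mu <- s) ('X - mu%:P)) *m F t) = 0) ->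
  mvanish (fun t => D *m F t).
Proof.
elim: s F g => [|mu s ih] F g sS Fd g0 DF.
  move=> i j; apply: cvanish_eventually0 => t t0; move: (DF t t0).
  by rewrite big_nil rmorph1 mul1mx => ->; rewrite mxE.
pose N := M - mu%:M.
have NF : mvanish (fun t => D *m (N *m F t)).
  apply: (ih _ (fun t => N *m g t)) => [nu nus|t t0||t t0].
  - by apply: sS; rewrite inE nus orbT.
  - have := mderiv_mull N (Fd t t0); rewrite !mulmxDr !mulmxA.
    have NM : N *m M = M *m N by rewrite mulmxBl mulmxBr scalar_mxC.
    by rewrite NM.
  - exact: mvanish_mull.
  - have := DF t t0; rewrite big_cons mulrC rmorphM.
    by rewrite rmorphB/= horner_mx_X horner_mx_C -mulmxE -!mulmxA.
apply: (sS mu (mem_head _ _) _ (fun t => D *m (N *m F t) *m Q + D *m g t)).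
  move=> t t0; apply: (mderiv_eq (mderiv_mull D (Fd t t0))).
  rewrite !mulmxDr addrA; congr (_ + _).
  rewrite -!mulmxA -addrA; congr (_ + _).
  rewrite /N mulmxBl !mulmxBr mul_scalar_mx -!scalemxAr.
  by rewrite addrC subrK.
by apply: mvanishD; [exact: mvanish_mulr|exact: mvanish_mull].
Qed.

Lemma stable_scalar (mu : C) : complex.Re mu < 0 -> stable (mu%:M : 'M[C]_1).
Proof.
move=> mu0 y g yd g0 i j; rewrite !ord1.
apply: (scalar_decay mu0 _ (g0 0 0)) => t t0.
have := yd t t0 0 0; congr cderiv.
by rewrite mxE; congr (_ + _); rewrite mul_mx_scalar mxE.
Qed.

Lemma char_poly_split N (T : 'M[C]_N) :
  { s : seq C | char_poly T = \prod_(mu <- s) ('X - mu%:P) }.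
Proof.
have [s cE] := closed_field_poly_normal (char_poly T); exists s.
by rewrite cE (monicP (char_poly_monic T)) scale1r.
Qed.

(** Modal reduction with scalar blocks: the eigenvalues of [T] list the modes,
    each of which is a scalar equation with decaying homogeneous part. *)
Lemma hurwitz_stable N (T : 'M[C]_N) : hurwitzC T -> stable T^T.
Proof.
case: N T => [|N] T hT y g yd g0; first by move=> i [].
have [s cE] := char_poly_split T.
suff h j : mvanish (fun t => (delta_mx 0 j : 'rV[C]_N.+1) *m (y t)^T).
  move=> i j; have := h j 0 i; congr cvanish; apply/funext => t.
  by rewrite -rowE !mxE.
apply: (@modal_reduction N 1 T 0 1%:M _ s _ (fun t => (g t)^T)).
- move=> mu mus; rewrite add0r scalemx1; apply/stable_scalar/hT.
  by rewrite eigenvalue_root_char cE root_prod_XsubC.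
- move=> t t0 i i'; have := yd t t0 i' i.
  have -> : (fun s => (y s)^T i i') = (fun s => y s i' i).
    by apply/funext => s'; rewrite mxE.
  congr cderiv; rewrite mulmx0 add0r mulmx1 -[T in RHS]trmxK -trmx_mul -raddfD.
  by rewrite [RHS]mxE.
- by move=> i i'; under eq_fun do rewrite mxE; exact: g0.
- by move=> t t0; rewrite -cE Cayley_Hamilton mul0mx mulmx0.
Qed.

End ModalReduction.

(** * Linear flows and Metzler matrices *)

Section LinearFlow.
Context {R : realType} {I : finType}.
Implicit Types (M : I -> I -> R) (v : I -> R) (y : R -> I -> R).

Definition linop M v : I -> R := fun i => \sum_j M i j * v j.

Definition flow_coef M v i (k : nat) : R := iter k (linop M) v i / k`!%:R.

(** The matrix exponential [exp (t M) v], coordinatewise, as a power series in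
    [t]. Matrices are indexed by an arbitrary finite type, since the states of a
    network are naturally indexed by pairs (agent, coordinate). *)
Definition flow M v (t : R) (i : I) : R := limn (pseries (flow_coef M v i) t).

Definition solves M y := forall i,
  (y t i @[t --> 0^'+] --> y 0 i) /\
  forall t : R, 0 < t -> is_derive t (1 : R) (fun s => y s i) (linop M (y t) i).

Let normM M : R := \sum_i \sum_j `|M i j|.

Let normM_ge0 M : 0 <= normM M.
Proof. by apply: sumr_ge0 => i _; apply: sumr_ge0. Qed.

Let row_normM M i : \sum_j `|M i j| <= normM M.
Proof.
by rewrite /normM [leRHS](bigD1 i)//= lerDl; apply: sumr_ge0 => k _; exact: sumr_ge0.
Qed.

Lemma iter_linop_bound M v k i :
  `|iter k (linop M) v i| <= normM M ^+ k * \sum_j `|v j|.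
Proof.
elim: k i => [|k ih] i.
  by rewrite expr0 mul1r /= [leRHS](bigD1 i)//= lerDl sumr_ge0.
rewrite iterS {1}/linop (le_trans (ler_norm_sum _ _ _))//.
under eq_bigr do rewrite normrM.
apply: (@le_trans _ _ (\sum_j `|M i j| * (normM M ^+ k * \sum_j `|v j|))).
  by apply: ler_sum => j _; rewrite ler_wpM2l.
rewrite -mulr_suml exprS -mulrA; apply: ler_wpM2r; last exact: row_normM.
by rewrite mulr_ge0 ?exprn_ge0 ?normM_ge0 ?sumr_ge0.
Qed.

Lemma flow_cvg M v i t : cvgn (pseries (flow_coef M v i) t).
Proof.
apply: normed_cvg => /=.
pose b := \sum_j `|v j|.
have b0 : 0 <= b by exact: sumr_ge0.
apply: (@series_le_cvg _ _ (fun k => b * exp_coeff (normM M * `|t|) k)) => [k|k|k|].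
- exact: normr_ge0.
- by rewrite mulr_ge0// exp_coeff_ge0// mulr_ge0 ?normM_ge0.
- rewrite /flow_coef /exp_coeff /= !normrM normfV normrX [`|k`!%:R|]ger0_norm//.
  rewrite exprMn mulrAC !mulrA ler_wpM2r ?invr_ge0// ler_wpM2r ?exprn_ge0//.
  by rewrite mulrC; exact: iter_linop_bound.
- exact: (@is_cvg_seriesZ _ _ b (is_cvg_series_exp_coeff (normM M * `|t|))).
Qed.

Lemma pseries_diffs_flow_coef M v i :
  pseries_diffs (flow_coef M v i) = flow_coef M (linop M v) i.
Proof.
apply/funext => k; rewrite /pseries_diffs /flow_coef iterSr factS natrM.
by rewrite invfM mulrCA mulVKf// pnatr_eq0.
Qed.

(** Shifting the coefficients of the series amounts to replacing [v] by [M v]. *)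
Lemma flow_derive M v i t :
  is_derive t (1 : R) (fun s => flow M v s i) (flow M (linop M v) t i).
Proof.
rewrite /flow -pseries_diffs_flow_coef.
apply: (@pseries_snd_diffs _ _ (`|t| + 1)); rewrite ?pseries_diffs_flow_coef;
  try exact: flow_cvg.
by rewrite [ltRHS]ger0_norm ?ltrDl// addr_ge0.
Qed.

(** Iterates of [M] commute with [M], so differentiating the series also multiplies
    it by [M] on the left. *)
Lemma flow_linop M v i t : flow M (linop M v) t i = linop M (flow M v t) i.
Proof.
rewrite /flow /linop; apply/cvg_lim => //.
have -> : pseries (flow_coef M (fun i0 => \sum_j M i0 j * v j) i) t =
    (fun n => \sum_j M i j * pseries (flow_coef M v j) t n).
  apply/funext => n; rewrite /pseries /series /=.
  under [RHS]eq_bigr do rewrite mulr_sumr.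
  rewrite exchange_big; apply: eq_bigr => k _ /=.
  rewrite /flow_coef -iterSr iterS /linop -mulrA mulr_suml; apply: eq_bigr => j _.
  by rewrite !mulrA.
by apply: cvg_sum_fin => j; apply: cvgZr; exact: flow_cvg.
Qed.

Lemma flow0 M v i : flow M v 0 i = v i.
Proof.
apply/cvg_lim => //; rewrite -cvg_shiftS /=; apply: cvg_near_cst; near=> n.
rewrite /pseries /series /= big_nat_recl//= big1 => [|k _].
  by rewrite expr0 /flow_coef /= divr1 mulr1 addr0.
by rewrite expr0n mulr0.
Unshelve. all: by end_near. Qed.

Lemma flow_solves M v : solves M (flow M v).
Proof.
move=> i; split => [|t _]; last by rewrite -flow_linop; exact: flow_derive.
have [/derivable1_diffP/differentiable_continuous cf _] := flow_derive M v i 0.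
by apply: cvg_within_filter; exact: cf.
Qed.

Lemma flow_ge0 M v t i : (forall i j, 0 <= M i j) -> (forall i, 0 <= v i) ->
  0 <= t -> 0 <= flow M v t i.
Proof.
move=> M0 v0 t0.
have it0 k j : 0 <= iter k (linop M) v j.
  by elim: k j => //= k ih j; apply: sumr_ge0 => l _; rewrite mulr_ge0.
apply: limr_ge; first exact: flow_cvg.
near=> n; rewrite /pseries /series /=; apply: sumr_ge0 => k _.
by rewrite mulr_ge0 ?exprn_ge0// divr_ge0.
Unshelve. all: by end_near. Qed.

Lemma flow_eq0 M v t i : (forall k, iter k (linop M) v i = 0) -> flow M v t i = 0.
Proof.
move=> v0; apply/cvg_lim => //; apply: cvg_near_cst; near=> n.
rewrite /pseries /series /= big1// => k _.
by rewrite /flow_coef v0 !mul0r.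
Unshelve. all: by end_near. Qed.

(** Energy estimate: [u := \sum_i y_i ^ 2] satisfies [u' <= 2 c u] with [c] the
    entrywise norm of [M], so [u exp (- 2 c t)] does not increase from [0]. *)
Lemma solves_unique0 M y : solves M y -> (forall i, y 0 i = 0) ->
  forall t i, 0 <= t -> y t i = 0.
Proof.
move=> yM y0.
pose u t := \sum_i y t i ^+ 2.
pose c := normM M.
(* Written [t - 0] to match [is_derive_expR_affine]. *)
pose w t := u t * expR (- (2 * c) * (t - 0)).
have ud (t : R) : 0 < t ->
    is_derive t (1 : R) u (\sum_i 2 * (y t i * linop M (y t) i)).
  move=> t0; apply: is_derive_sum_fin => i; have yd := (yM i).2 t t0.
  have -> : (fun s => y s i ^+ 2) = (fun s => y s i) ^+ 2 by apply/funext.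
  apply: is_derive_eq; rewrite /GRing.scale/= !expr1; ring.
have wd (t : R) (t0 : 0 < t) :
    is_derive t (1 : R) w ((\sum_i 2 * (y t i * linop M (y t) i) - 2 * c * u t) *
      expR (- (2 * c) * (t - 0))).
  have udt := ud _ t0; have ex := is_derive_expR_affine (- (2 * c)) 0 t.
  have -> : w = u * (fun s => expR (- (2 * c) * (s - 0))) by apply/funext.
  apply: is_derive_eq; rewrite /GRing.scale/=; ring.
have u0 t : 0 <= u t by apply: sumr_ge0 => i _; exact: sqr_ge0.
have uN t : \sum_i 2 * (y t i * linop M (y t) i) <= 2 * c * u t.
  have yu j : y t j ^+ 2 <= u t.
    by rewrite /u (bigD1 j)//= lerDl sumr_ge0// => k _; exact: sqr_ge0.
  (* [|y_i y_j| <= (y_i ^ 2 + y_j ^ 2) / 2 <= u]. *)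
  rewrite -mulr_sumr -mulrA ler_pM2l// {1}/c /normM mulr_suml.
  apply: ler_sum => i _; rewrite /linop mulr_sumr mulr_suml.
  apply: ler_sum => j _; apply: le_trans (ler_norm _) _.
  rewrite !normrM mulrCA ler_wpM2l//.
  have := yu i; have := yu j.
  rewrite -[y t i ^+ 2]real_normK ?num_real// -[y t j ^+ 2]real_normK ?num_real//.
  have := sqr_ge0 (`|y t i| - `|y t j|); rewrite sqrrB; lra.
have w0 : w 0 = 0.
  by rewrite /w /u big1 ?mul0r// => i _; rewrite y0 expr0n.
have ewd t : is_derive t (1 : R) (fun s => expR (- (2 * c) * (s - 0))) _ :=
  is_derive_expR_affine (- (2 * c)) 0 t.
have wle t : 0 <= t -> w t <= w 0.
  apply: (nonincreasing_of_derive wd) => [s s0|].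
    by rewrite mulr_le0_ge0 ?expR_ge0// subr_le0.
  apply: cvgM.
    by apply: cvg_sum_fin => i; apply: cvgM; exact: (yM i).1.
  have [/derivable1_diffP/differentiable_continuous ce _] := ewd 0.
  by apply: cvg_within_filter; exact: ce.
move=> t i t0; have := wle t t0; rewrite w0 /w pmulr_lle0 ?expR_gt0// => ut.
have /eqP : u t = 0 by apply/le_anti; rewrite ut u0.
rewrite psumr_eq0 => [/allP /(_ i)|j _]; last exact: sqr_ge0.
by rewrite mem_index_enum sqrf_eq0 => /(_ isT) /eqP.
Qed.

(** Multiplying the solution by [exp (c t)] replaces [M] by [M + c I], which is
    entrywise non-negative for large [c]; its flow is a power series with
    non-negative terms, and by uniqueness it is the rescaled solution. *)
Lemma metzler_solves_ge0 M y : (forall i j, i != j -> 0 <= M i j) ->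
  solves M y -> (forall i, 0 <= y 0 i) -> forall t i, 0 <= t -> 0 <= y t i.
Proof.
move=> M0 yM y0.
pose c := normM M.
pose P i j := M i j + c *+ (i == j).
pose z t i := y t i * expR (c * (t - 0)).
have P0 i j : 0 <= P i j.
  rewrite /P; case: eqVneq => [<-|ij]; last by rewrite addr0; exact: M0.
  rewrite mulr1n -lerBlDl sub0r (le_trans (ler_norm _))// normrN.
  by rewrite (le_trans _ (row_normM M i))// [leRHS](bigD1 i)//= lerDl sumr_ge0.
have PE v i : linop P v i = linop M v i + c * v i.
  rewrite /linop /P; under eq_bigr do rewrite mulrDl.
  rewrite big_split; congr (_ + _) => /=.
  rewrite (bigD1 i)//= eqxx mulr1n big1 ?addr0// => j ji.
  by rewrite eq_sym (negbTE ji) mulr0n mul0r.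
have zd i (t : R) : 0 < t -> is_derive t (1 : R) (fun s => z s i) (linop P (z t) i).
  move=> t0; have yd := (yM i).2 t t0; have ex := is_derive_expR_affine c 0 t.
  have -> : (fun s => z s i) = (fun s => y s i) * (fun s => expR (c * (s - 0))).
    by apply/funext.
  apply: is_derive_eq; rewrite PE /GRing.scale/=.
  have -> : linop M (z t) i = linop M (y t) i * expR (c * (t - 0)).
    by rewrite /linop mulr_suml; apply: eq_bigr => j _; rewrite mulrA.
  rewrite /z; ring.
have zr i : z t i @[t --> 0^'+] --> z 0 i.
  apply: cvgM; first exact: (yM i).1.
  have [/derivable1_diffP/differentiable_continuous ce _] :=
    is_derive_expR_affine c 0 0.
  by apply: cvg_within_filter; exact: ce.
have fs := @flow_solves P (z 0).
have zE t i : 0 <= t -> z t i = flow P (z 0) t i.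
  move=> t0; apply/eqP; rewrite -subr_eq0; apply/eqP.
  apply: (@solves_unique0 P (fun t i => z t i - flow P (z 0) t i)) => // [j|j];
    last by rewrite flow0 subrr.
  split=> [|s s0]; first by apply: cvgB; [exact: zr|exact: (fs j).1].
  have -> : linop P (fun i => z s i - flow P (z 0) s i) j =
      linop P (z s) j - linop P (flow P (z 0) s) j.
    by rewrite /linop -sumrB; apply: eq_bigr => k _; rewrite mulrBr.
  by have d1 := zd j s s0; have d2 := (fs j).2 s s0; exact: is_deriveB.
move=> t i t0; rewrite -(pmulr_lge0 _ (expR_gt0 (c * (t - 0)))) -/(z t i) zE//.
by apply: flow_ge0 => // j; rewrite /z mulr_ge0 ?expR_ge0.
Qed.

Lemma derive_ge0_at_min0 (f : R -> R) d : f 0 = 0 -> (forall t, 0 <= t -> 0 <= f t) ->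
  is_derive (0 : R) (1 : R) f d -> 0 <= d.
Proof.
move=> f0 fge [fd <-]; move: fd; rewrite /derive /derivable => fd.
have fr : cvg (h^-1 *: (f (h *: 1 + 0) - f 0) @[h --> (0:R)^'+]).
  apply/cvg_ex; exists (lim (h^-1 *: (f (h *: (1:R) + 0) - f 0) @[h --> (0:R)^'])).
  exact: cvg_dnbhs_at_right.
have -> : lim (h^-1 *: (f (h *: (1:R) + 0) - f 0) @[h --> (0:R)^']) =
          lim (h^-1 *: (f (h *: (1:R) + 0) - f 0) @[h --> (0:R)^'+]).
  by apply/esym/cvg_lim => //; exact: cvg_dnbhs_at_right.
apply: limr_ge => //; near=> h.
have h0 : 0 < h by near: h; exact: nbhs_right_gt.
by rewrite f0 subr0 addr0 /GRing.scale/= mulr1 mulr_ge0 ?invr_ge0 ?fge ?ltW.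
Unshelve. all: by end_near. Qed.

(** The entry [M i j] is the initial velocity of coordinate [i], which starts at
    [0], when the system is released from the [j]-th basis vector. *)
Lemma flow_ge0_metzler M : (forall j t i, 0 <= t -> 0 <= flow M (fun k => (k == j)%:R) t i) ->
  forall i j, i != j -> 0 <= M i j.
Proof.
move=> M0 i j ij.
have := derive_ge0_at_min0 _ (fun t => M0 j t i) (flow_derive M _ i 0).
rewrite !flow0 (negbTE ij) => /(_ erefl).
rewrite /linop (bigD1 j)//= eqxx mulr1 big1 ?addr0// => k kj.
by rewrite (negbTE kj) mulr0.
Qed.

End LinearFlow.

(** * The Laplacian of a graph with a spanning tree *)

Section GraphLaplacian.
Context {R : realType} (n : nat) (E : rel 'I_n).
Hypotheses (hE : irreflexive E) (htree : has_spanning_tree E).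
Local Notation C := R[i].
Local Notation L := (laplacian R E).
Local Notation adj := (adjacency R E).
Implicit Types (w : 'I_n -> R).

Lemma adjacency_ge0 i j : 0 <= adj i j.
Proof. by rewrite mxE ler0n. Qed.

Lemma laplacian_apply w i :
  \sum_j L i j * w j = \sum_j adj i j * (w i - w j).
Proof.
under [RHS]eq_bigr do rewrite mulrBr.
rewrite sumrB -mulr_suml (bigD1 i)//= [X in _ = _ - X](bigD1 i)//=.
rewrite [adj i i]mxE hE mul0r add0r mxE eqxx -sumrN; congr (_ + _).
by apply: eq_bigr => j ji; rewrite mxE eq_sym (negbTE ji) mulNr.
Qed.

(** Evaluate at a vertex where [w] is maximal: all terms [w i - w j] are
    non-negative there. *)
Lemma laplacian_const_ge0 w c : (forall i, \sum_j L i j * w j = c) -> 0 <= c.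
Proof.
move=> wc; have [root _] := htree.
have [m _ wmax] := arg_maxP w (erefl : xpredT root).
have wm j : w j <= w m by exact: wmax.
rewrite -(wc m) laplacian_apply; apply: sumr_ge0 => j _.
by rewrite mulr_ge0 ?adjacency_ge0// subr_ge0 wm.
Qed.

(** Maximum principle: at a vertex where [w] is maximal the vanishing sum of
    non-negative terms forces the same value at every vertex with an edge into
    it, so maximality propagates backwards along paths up to the root. *)
Lemma laplacian_ker_root_max w root : (forall v, connect E root v) ->
  (forall i, \sum_j L i j * w j = 0) -> forall i, w i <= w root.
Proof.
move=> tree w0.
have [m _ wmax] := arg_maxP w (erefl : xpredT root).
have wm j : w j <= w m by exact: wmax.
suff back x y : connect E x y -> w y = w m -> w x = w m.
  by move=> i; rewrite (back root m)//; apply: wm.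
move=> /connectP[p + ->]; elim: p x => //= z p ih x /andP[xz zp] /(ih _ zp) wz.
have := w0 z; rewrite laplacian_apply => /eqP.
rewrite psumr_eq0 => [/allP /(_ x)|j _]; last first.
  by rewrite mulr_ge0 ?adjacency_ge0// subr_ge0 wz wm.
rewrite mem_index_enum mxE xz mul1r subr_eq0 wz => /(_ isT) /eqP.
by [].
Qed.

(** Apply the two preceding lemmas to [w] and [- w]. As the kernel consists of
    the constant vectors, the first part excludes generalized eigenvectors of
    order two for the eigenvalue [0]. *)
Lemma laplacian_const w c : (forall i, \sum_j L i j * w j = c) ->
  c = 0 /\ forall i j, w i = w j.
Proof.
have opp w' c' : (forall i, \sum_j L i j * w' j = c') ->
    forall i, \sum_j L i j * - w' j = - c'.
  by move=> wc i; rewrite -(wc i) -sumrN; apply: eq_bigr => j _; rewrite mulrN.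
move=> wc; have c0 : c = 0.
  have := laplacian_const_ge0 wc; have := laplacian_const_ge0 (opp _ _ wc); lra.
split=> // i j; rewrite c0 in wc.
have [root tree] := htree.
have wroot k : w k = w root.
  apply/le_anti; rewrite (laplacian_ker_root_max tree wc)/= -lerN2.
  by apply: (@laplacian_ker_root_max (fun l => - w l)) => // l; rewrite (opp _ _ wc) oppr0.
by rewrite !wroot.
Qed.

Lemma laplacian_kernelC k (u : 'M[C]_(n, k)) : complex_mx L *m u = 0 ->
  forall i j a, u i a = u j a.
Proof.
move=> Lu i j a.
have Lua l : \sum_h (L l h)%:C%C * u h a = 0.
  have /matrixP/(_ l a) := Lu; rewrite [LHS]mxE [RHS]mxE.
  by under eq_bigr do rewrite [complex_mx _ _ _]mxE.
have [_ re] : 0 = 0 :> R /\ forall i j, complex.Re (u i a) = complex.Re (u j a).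
  apply: laplacian_const => l; have /(congr1 (@complex.Re R)) := Lua l.
  rewrite raddf_sum /= => Lua0; rewrite -[RHS]Lua0; apply: eq_bigr => h _.
  by case: (u h a) => x y /=; rewrite mul0r subr0.
have [_ im] : 0 = 0 :> R /\ forall i j, complex.Im (u i a) = complex.Im (u j a).
  apply: laplacian_const => l; have /(congr1 (@complex.Im R)) := Lua l.
  rewrite raddf_sum /= => Lua0; rewrite -[RHS]Lua0; apply: eq_bigr => h _.
  by case: (u h a) => x y /=; rewrite mul0r addr0.
by move: (re i j) (im i j); case: (u i a) (u j a) => ? ? [? ?] /= -> ->.
Qed.

Lemma laplacian_row_sum i : \sum_j L i j = 0.
Proof.
transitivity (\sum_j L i j * (fun=> 1) j); first by apply: eq_bigr => j _; rewrite mulr1.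
by rewrite laplacian_apply// big1// => j _; rewrite subrr mulr0.
Qed.

End GraphLaplacian.

(** The eigenvalue [0] is algebraically simple. Let [J] be the matrix whose first
    column is constant [1] and whose other entries are [0]. Since [L J = 0],
    [('X - L) ('X - J) = 'X ('X - (L + J))], so that
    [char_poly L * ('X - 1) = 'X * char_poly (L + J)]. A second factor ['X] of
    [char_poly L] would make [L + J] singular; but a vector [w] in its kernel has
    [L w] constant, hence [w] is constant and [L w = 0], and then [J w = 0] gives
    [w = 0]. *)
Lemma laplacian_eigenvalue_neq0 {R : realType} (n : nat) (E : rel 'I_n)
    (lam : 'I_n -> R[i]) (hE : irreflexive E) (htree : has_spanning_tree E)
    (hlam : laplacian_spectrum E lam) (i : 'I_n) : (1 <= i)%N -> lam i != 0.
Proof.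
case: n E lam hE htree hlam i => [|n] E lam hE htree [chi lam0 _] i; first by case: i.
move=> i0; apply/negP => /eqP lami.
pose L := laplacian R E.
pose J : 'M[R]_n.+1 := \matrix_(i, j) (j == 0)%:R.
have chi0 k : (k < 2)%N -> (char_poly L)`_k = 0.
  move=> k2; apply: (@complexI R); rewrite -coef_map map_char_poly.
  rewrite -/(complex_mx L) chi (bigD1 ord0)//= (bigD1 i)/=; last first.
    by rewrite -(inj_eq val_inj) /= -lt0n.
  by rewrite lam0// lami subr0 mulrA -expr2 mulrC coefMXn k2.
have LJ : L *m J = 0.
  apply/matrixP => k j; rewrite [LHS]mxE [RHS]mxE.
  under eq_bigr do rewrite [J _ _]mxE.
  by rewrite -mulr_suml laplacian_row_sum// mul0r.
have chiJ : char_poly J = ('X - 1%:P) * 'X ^+ n.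
  rewrite char_poly_trig; last first.
    by apply/is_trig_mxP => k j kj; rewrite mxE -(inj_eq val_inj)/= gtn_eqF// (leq_ltn_trans _ kj).
  rewrite big_ord_recl mxE eqxx; congr (_ * _).
  rewrite (eq_bigr (fun=> 'X)) ?prodr_const ?card_ord// => k _.
  by rewrite mxE /= subr0.
(* Determinants of [('X - L) ('X - J) = 'X ('X - (L + J))]. *)
have key : char_poly L * char_poly J = 'X ^+ n.+1 * char_poly (L + J).
  rewrite /char_poly -det_mulmx -detZ; congr (\det _).
  rewrite /char_poly_mx mulmxBl !mulmxBr -map_mxM LJ map_mx0 subr0.
  by rewrite !mul_scalar_mx mul_mx_scalar scalerBr map_mxD scalerDr opprD addrA addrAC.
have det0 : \det (L + J) = 0.
  have : char_poly L * ('X - 1%:P) = 'X * char_poly (L + J).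
    apply: (@mulIf _ ('X ^+ n)); first by rewrite expf_neq0// polyX_eq0.
    by rewrite -mulrA -chiJ key exprS mulrAC.
  move=> /(congr1 (fun p : {poly R} => p`_1)).
  rewrite mulrBr mulr1 coefB coefMX coefXM /= !chi0// subrr char_poly_det => /esym/eqP.
  by rewrite mulf_eq0 signr_eq0 => /eqP.
have /eqP/det0P[v v0 vLJ] : \det (L + J)^T = 0 by rewrite det_tr.
have vL k : \sum_j L k j * v 0 j = - v 0 0.
  have /rowP/(_ k) := vLJ; rewrite [LHS]mxE [RHS]mxE.
  under eq_bigr do rewrite [(L + J)^T _ _]mxE [(L + J) _ _]mxE [J _ _]mxE mulrDr mulrC.
  rewrite big_split/= [X in _ + X](bigD1 0)//= mulr1 [X in _ + (_ + X)]big1 => [|j j0].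
    by rewrite addr0 => /eqP; rewrite addr_eq0 => /eqP.
  by rewrite (negbTE j0) mulr0.
have [v00 vcst] := laplacian_const hE htree vL.
move/negP: v0; apply; apply/eqP/rowP => j.
by rewrite (vcst j 0) mxE; apply/eqP; rewrite -oppr_eq0 v00.
Qed.

(** * Modes that obstruct consensus *)

Section Modes.
Context {R : realType}.
Local Notation C := R[i].

Lemma cderiv_real (f : R -> R) (t d : R) : is_derive t (1 : R) f d ->
  cderiv (fun s => (f s)%:C%C) t d%:C%C.
Proof. by move=> fd; split => //=; exact: is_derive_cst. Qed.

Lemma cvanish_real (f : R -> R) :
  cvanish (fun s => (f s)%:C%C) <-> f t @[t --> +oo] --> (0 : R).
Proof. by split=> [[]//|f0]; split => //=; exact: cvg_cst. Qed.

Lemma Re_sum_real (I : finType) (c : I -> C) (x : I -> R) :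
  complex.Re (\sum_k c k * (x k)%:C%C) = \sum_k complex.Re (c k) * x k.
Proof.
rewrite raddf_sum; apply: eq_bigr => k _ /=.
by case: (c k) => u v /=; rewrite mulr0 subr0.
Qed.

Lemma Im_sum_real (I : finType) (c : I -> C) (x : I -> R) :
  complex.Im (\sum_k c k * (x k)%:C%C) = \sum_k complex.Im (c k) * x k.
Proof.
rewrite raddf_sum; apply: eq_bigr => k _ /=.
by case: (c k) => u v /=; rewrite mulr0 add0r.
Qed.

(** A left eigenvector [l] of [M] for [z] turns a solution into a scalar mode
    [s' = z s]. If [l] annihilates all states in which the agents agree, then
    consensus forces [s] to vanish at infinity, so for [0 <= Re z] it vanishes
    from the start. The eigenvector equation is only required on the coordinates
    where the solution is not identically [0]. *)
Lemma mode_obstruction n (J : finType) (M : 'I_n * J -> 'I_n * J -> R)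
    (y : R -> 'I_n * J -> R) (l : 'I_n * J -> C) (z : C) :
  solves M y ->
  (forall i j a, y t (j, a) - y t (i, a) @[t --> +oo] --> (0 : R)) ->
  (forall a, \sum_i l (i, a) = 0) ->
  (forall t q, (\sum_p l p * (M p q)%:C%C) * (y t q)%:C%C = z * l q * (y t q)%:C%C) ->
  0 <= complex.Re z ->
  \sum_p l p * (y 0 p)%:C%C = 0.
Proof.
move=> yM ycons l0 lM z0.
apply: (nondecaying_mode (f := fun t => \sum_p l p * (y t p)%:C%C) z0).
- move=> t t0.
  have -> : z * (\sum_p l p * (y t p)%:C%C) = \sum_p l p * (linop M (y t) p)%:C%C.
    rewrite mulr_sumr; under eq_bigr do rewrite mulrA -lM mulr_suml.
    rewrite exchange_big; apply: eq_bigr => p _ /=.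
    by rewrite /linop raddf_sum mulr_sumr; apply: eq_bigr => q _ /=; rewrite rmorphM mulrA.
  by apply: cderiv_lincomb => p; apply: cderiv_real; exact: (yM p).2.
- under eq_fun do rewrite Re_sum_real; rewrite Re_sum_real.
  by apply: cvg_sum_fin => p; apply: cvgZr; exact: (yM p).1.
- under eq_fun do rewrite Im_sum_real; rewrite Im_sum_real.
  by apply: cvg_sum_fin => p; apply: cvgZr; exact: (yM p).1.
(* Because [l] annihilates consensus states, subtracting the state of a fixed
   agent from all others does not change the functional. *)
- case: n M y l yM ycons l0 lM => [|n] M y l yM ycons l0 lM.
    apply: cvanish_eventually0 => t _; apply: big1 => -[[]//].
  have -> : (fun t => \sum_p l p * (y t p)%:C%C) =
      (fun t => \sum_p l p * (y t p - y t (ord0, p.2))%:C%C).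
    apply/funext => t; apply/eqP; rewrite -subr_eq0 -sumrB; apply/eqP.
    transitivity (\sum_(p : 'I_n.+1 * J) l (p.1, p.2) * (y t (ord0, p.2))%:C%C).
      by apply: eq_bigr => -[i a] _; rewrite rmorphB /= mulrBr opprB addrC subrK.
    rewrite -(pair_bigA _ (fun i a => l (i, a) * (y t (ord0, a))%:C%C)) exchange_big.
    by apply: big1 => a _; rewrite -mulr_suml l0 mul0r.
  by apply: cvanish_lincomb => -[i a]; apply/cvanish_real/ycons.
Qed.
End Modes.

(** * The closed-loop system as one linear system *)

Section ColumnVectors.
Context {R : realType} {k : nat}.

Lemma cvg_cvP (F : set_system R) (FF : Filter F) (x : R -> 'cV[R]_k) (l : 'cV[R]_k) :
  x t @[t --> F] --> l <-> forall a, x t a 0 @[t --> F] --> l a 0.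
Proof.
split=> [xl a|xl].
  apply: (@cvg_comp _ _ _ x (fun u : 'cV[R]_k => u a 0) _ _ _ xl).
  exact: coord_continuous.
move=> A [P Pl PA]; rewrite nbhs_filterE.
have : \forall t \near F, forall a : 'I_k, P a 0 (x t a 0).
  by apply: filter_forall => a; exact: xl.
by apply: filterS => t xP; apply: PA => a b /=; rewrite ord1.
Qed.

Lemma is_derive_cvP (x : R -> 'cV[R]_k) (t : R) (d : 'cV[R]_k) :
  is_derive t (1 : R) x d <->
  forall a, is_derive t (1 : R) (fun s => x s a 0) (d a 0).
Proof.
split=> [[xd <-] a|xd].
  by split; [exact: (derivable_mxP _ _ _).1|rewrite derive_mx// mxE].
have dx : derivable x t 1.
  by apply/derivable_mxP => a b; rewrite ord1; have [] := xd a.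
split=> //; rewrite derive_mx//; apply/colP => a; rewrite mxE.
by have [] := xd a.
Qed.
End ColumnVectors.

Lemma subZmxE (R : nzRingType) k l (M N : 'M[R]_(k, l)) c a b :
  (M - c *: N) a b = M a b - c * N a b.
Proof. by rewrite !mxE. Qed.

Section ClosedLoop.
Context {R : realType} (n r m p : nat) (E : rel 'I_n)
  (A : 'M[R]_r) (B : 'M[R]_(r, m)) (C : 'M[R]_(p, r))
  (K : 'M[R]_(m, r)) (L : 'M[R]_(r, p)).
Hypothesis hE : irreflexive E.
Local Notation lap := (laplacian R E).
Local Notation state := ('I_n * 'I_(r + r))%type.

Definition output_injection : 'M[R]_(r + r) := block_mx 0 0 0 (L *m C).

(** The matrix of the closed loop of all agents, indexed by pairs (agent,
    coordinate): the Kronecker expression [I (x) tildeA - L (x) (tildeB L tildeC)]. *)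
Definition network (u v : state) : R :=
  (u.1 == v.1)%:R * tildeA A B K u.2 v.2 - lap u.1 v.1 * output_injection u.2 v.2.

Lemma network_state_state i j a b :
  network (i, lshift r a) (j, lshift r b) = (i == j)%:R * (A - B *m K) a b.
Proof.
by rewrite /network /tildeA /output_injection !block_mxEul [X in _ - _ * X]mxE
  mulr0 subr0.
Qed.

Lemma network_state_error i j a b :
  network (i, lshift r a) (j, rshift r b) = (i == j)%:R * (B *m K) a b.
Proof.
by rewrite /network /tildeA /output_injection !block_mxEur [X in _ - _ * X]mxE
  mulr0 subr0.
Qed.

Lemma network_error_state i j a b :
  network (i, rshift r a) (j, lshift r b) = 0.
Proof.
by rewrite /network /tildeA /output_injection !block_mxEdl [X in _ * X - _]mxE
  [X in _ - _ * X]mxE !mulr0 subr0.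
Qed.

Lemma network_error_error i j a b :
  network (i, rshift r a) (j, rshift r b) =
  (i == j)%:R * A a b - lap i j * (L *m C) a b.
Proof. by rewrite /network /tildeA /output_injection !block_mxEdr. Qed.

Lemma output_injectionE : tildeB R r *m L *m tildeC C = output_injection.
Proof.
rewrite /tildeB /tildeC mul_col_mx mul0mx mul1mx mul_col_row /output_injection.
by rewrite !mul0mx mulmx0.
Qed.

Lemma linop_network (y : state -> R) i a :
  linop network y (i, a) =
  \sum_b tildeA A B K a b * y (i, b) -
  \sum_b output_injection a b * \sum_j lap i j * y (j, b).
Proof.
transitivity (\sum_j \sum_b network (i, a) (j, b) * y (j, b)).
  by rewrite pair_bigA; apply: eq_bigr => -[].
rewrite /network /=.
under eq_bigr do under eq_bigr do rewrite mulrBl.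
under eq_bigr do rewrite sumrB.
rewrite sumrB; congr (_ - _).
  rewrite (bigD1 i)//= [X in _ + X]big1 ?addr0 => [|j ji].
    by apply: eq_bigr => b _; rewrite eqxx mul1r.
  by apply: big1 => b _; rewrite eq_sym (negbTE ji) !mul0r.
rewrite exchange_big; apply: eq_bigr => b _ /=.
by rewrite mulr_sumr; apply: eq_bigr => j _; rewrite mulrCA mulrA.
Qed.

Lemma closed_loop_solvesE (x : 'I_n -> R -> 'cV[R]_(r + r)) :
  closed_loop_solution E A B C K L x <->
  solves network (fun t u => x u.1 t u.2 0).
Proof.
have rhs i t a : (tildeA A B K *m x i t + tildeB R r *m L *m tildeC C *m
       (\sum_(j < n) adjacency R E i j *: (x j t - x i t))) a 0 =
    linop network (fun u => x u.1 t u.2 0) (i, a).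
  rewrite linop_network output_injectionE [LHS]mxE [X in X + _]mxE [X in _ + X]mxE.
  congr (_ + _); rewrite -sumrN; apply: eq_bigr => b _.
  rewrite -mulrN; congr (_ * _).
  rewrite (laplacian_apply hE (fun j => x j t b 0)) summxE -sumrN.
  by apply: eq_bigr => j _; rewrite [LHS]mxE [X in _ * X]mxE [X in _ * (_ + X)]mxE -mulrN opprB.
split=> [xs [i a]|xs i]; split.
- by apply: (cvg_cvP _ _ _).1; exact: (xs i).1.
- move=> t t0; rewrite -rhs /=.
  by have /is_derive_cvP := (xs i).2 t t0; apply.
- by apply/cvg_cvP => a; exact: (xs (i, a)).1.
- move=> t t0; apply/is_derive_cvP => a; rewrite rhs.
  exact: (xs (i, a)).2.
Qed.

Lemma linop_network_state (y : state -> R) i a :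
  linop network y (i, lshift r a) =
  \sum_b (A - B *m K) a b * y (i, lshift r b) +
  \sum_b (B *m K) a b * y (i, rshift r b).
Proof.
rewrite linop_network !big_split_ord /= /output_injection /tildeA.
under eq_bigr do rewrite block_mxEul.
under [X in _ + X - _]eq_bigr do rewrite block_mxEur.
rewrite [X in _ - (X + _)]big1 => [|b _]; last by rewrite block_mxEul mxE mul0r.
rewrite [X in _ - (_ + X)]big1 => [|b _]; last by rewrite block_mxEur mxE mul0r.
by rewrite addr0 subr0.
Qed.

Lemma linop_network_error (y : state -> R) i a :
  linop network y (i, rshift r a) =
  \sum_b A a b * y (i, rshift r b) -
  \sum_b (L *m C) a b * \sum_j lap i j * y (j, rshift r b).
Proof.
rewrite linop_network !big_split_ord /= /output_injection /tildeA.
rewrite [X in X + _ - _]big1 => [|b _]; last by rewrite block_mxEdl mxE mul0r.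
rewrite [X in _ - (X + _)]big1 => [|b _]; last by rewrite block_mxEdl mxE mul0r.
under eq_bigr do rewrite block_mxEdr.
under [X in _ - (_ + X)]eq_bigr do rewrite block_mxEdr.
by rewrite !add0r.
Qed.

Lemma lap_diag_le i : lap i i <= lmax R E.
Proof. exact: (le_bigmax _ (fun i => lap i i) i). Qed.

Lemma lap_offdiag i j : i != j -> lap i j = - (E j i)%:R.
Proof. by move=> ij; rewrite !mxE (negbTE ij). Qed.

(** A path from the root to any second vertex starts with an edge. *)
Lemma spanning_tree_edge : (2 <= n)%N -> has_spanning_tree E ->
  exists i j, E j i /\ i != j.
Proof.
move=> n2 [root tree].
have [v vr] : exists v : 'I_n, v != root.
  have /card_gt0P[v] : (0 < #|predC1 root|)%N.
    by rewrite cardC1 card_ord -ltnS prednK// ltnW.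
  by rewrite inE => vr; exists v.
have /connectP[[|z q]] := tree v; first by move=> _ vE; rewrite vE eqxx in vr.
move=> /= /andP[rz _] _; exists z, root; split=> //.
by apply: contraTneq rz => ->; rewrite hE.
Qed.

(** Off-diagonal entries of the closed loop are read off block by block: the
    coupling along one edge gives [L C], and the blocks of a single agent give
    the rest. The bound with [l_max] holds as it does for every degree, and
    for [0] because [A] is Metzler. *)
Lemma network_metzler_design : (2 <= n)%N -> has_spanning_tree E -> metzler A ->
  (forall u v, u != v -> 0 <= network u v) ->
  [/\ nonneg_mx (B *m K), metzler (A - B *m K), nonneg_mx (L *m C) &
      metzler (A - lmax R E *: (L *m C))].
Proof.
move=> n2 tree hA net.
have [i0 _] := tree.
split.
- move=> a b; have := net (i0, lshift r a) (i0, rshift r b).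
  by rewrite network_state_error xpair_eqE eq_lrshift andbF eqxx mul1r => /(_ isT).
- move=> a b ab; have := net (i0, lshift r a) (i0, lshift r b).
  rewrite network_state_state xpair_eqE (inj_eq (@lshift_inj _ _)) eqxx mul1r.
  by apply.
- move=> a b; have [i [j [ji ij]]] := spanning_tree_edge n2 tree.
  have := net (i, rshift r a) (j, rshift r b).
  rewrite network_error_error xpair_eqE (negbTE ij) lap_offdiag// ji.
  by rewrite mul0r sub0r mulN1r opprK; apply.
- move=> a b ab; rewrite subZmxE subr_ge0.
  have lab i : lap i i * (L *m C) a b <= A a b.
    have := net (i, rshift r a) (i, rshift r b).
    rewrite network_error_error xpair_eqE (inj_eq (@rshift_inj _ _)) eqxx mul1r.
    by rewrite subr_ge0; apply.
  rewrite /lmax; apply: (big_ind (fun l => l * (L *m C) a b <= A a b)) => //.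
    by rewrite mul0r hA.
  by move=> u v; rewrite maxEle; case: ifP.
Qed.

Lemma network_metzler : nonneg_mx (B *m K) -> metzler (A - B *m K) ->
  nonneg_mx (L *m C) -> metzler (A - lmax R E *: (L *m C)) ->
  forall u v, u != v -> 0 <= network u v.
Proof.
move=> BK ABK LC ALC [i a] [j b].
case: (split_ordP a) => a' ->; case: (split_ordP b) => b' ->.
- rewrite network_state_state xpair_eqE (inj_eq (@lshift_inj _ _)).
  by case: eqVneq => [_ ab|_ _]; rewrite ?mul0r// mul1r; exact: ABK.
- by rewrite network_state_error mulr_ge0.
- by rewrite network_error_state.
- rewrite network_error_error xpair_eqE (inj_eq (@rshift_inj _ _)).
  case: (eqVneq i j) => [<- ab|ij _]; last first.
    by rewrite mul0r sub0r lap_offdiag// mulNr opprK mulr_ge0.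
  rewrite mul1r subr_ge0; have := ALC _ _ ab; rewrite subZmxE subr_ge0.
  by apply: le_trans; apply: ler_wpM2r; [exact: LC|exact: lap_diag_le].
Qed.

End ClosedLoop.

(** * Consensus and the Hurwitz conditions *)

Section Consensus.
Context {R : realType} (n r m p : nat) (E : rel 'I_n.+1) (lam : 'I_n.+1 -> R[i])
  (A : 'M[R]_r) (B : 'M[R]_(r, m)) (C : 'M[R]_(p, r))
  (K : 'M[R]_(m, r)) (L : 'M[R]_(r, p)).
Hypotheses (hE : irreflexive E) (htree : has_spanning_tree E)
  (hlam : laplacian_spectrum E lam).
Local Notation lap := (laplacian R E).
Local Notation state := ('I_n.+1 * 'I_(r + r))%type.
Local Notation net := (network E A B C K L).

Section Design.
Hypothesis hABK : hurwitz (A - B *m K).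
Hypothesis hALC : forall i : 'I_n.+1, (1 <= i)%N ->
  hurwitzC (complex_mx A - lam i *: complex_mx (L *m C)).
Variable y : R -> state -> R.
Hypothesis hy : solves net y.

Lemma char_poly_laplacian_split : exists s : seq R[i],
  char_poly (complex_mx lap) = 'X * \prod_(mu <- s) ('X - mu%:P) /\
  forall mu, mu \in s -> exists2 i : 'I_n.+1, (1 <= i)%N & mu = lam i.
Proof.
have [chi lam0 _] := hlam.
exists [seq lam (lift ord0 i) | i <- index_enum 'I_n]; split.
  by rewrite chi big_ord_recl lam0// subr0 big_map.
by move=> mu /mapP[i _ ->]; exists (lift ord0 i).
Qed.

(** Modal reduction along the eigenvalues other than the first. Their product
    [q] satisfies [L q(L) = 0] by Cayley-Hamilton, so [q(L)] maps the errors into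
    the kernel of the Laplacian, the constant vectors, on which the difference
    of two agents is [0]. *)
Lemma error_consensus i j a :
  y t (j, rshift r a) - y t (i, rshift r a) @[t --> +oo] --> (0 : R).
Proof.
have [s [chi sE]] := char_poly_laplacian_split.
pose F t : 'M[R[i]]_(n.+1, r) := \matrix_(i, a) (y t (i, rshift r a))%:C%C.
pose D : 'rV[R[i]]_n.+1 := delta_mx 0 j - delta_mx 0 i.
have DE (X : 'M[R[i]]_(n.+1, r)) b : (D *m X) 0 b = X j b - X i b.
  rewrite mulmxBl -!rowE [LHS]mxE [X in X + _]mxE [X in _ + X]mxE.
  by rewrite [X in _ - X]mxE.
suff FD : mvanish (fun t => D *m F t).
  apply/cvanish_real; have := FD 0 a; congr cvanish; apply/funext => t.
  by rewrite DE [F _ _ _]mxE [F _ _ _]mxE rmorphB.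
pose G := complex_mx (L *m C).
apply: (modal_reduction (M := complex_mx lap) (P := (complex_mx A)^T) (Q := - G^T)
  (s := s) (g := fun=> 0)).
- move=> mu /sE[k k1 ->]; have := hurwitz_stable (hALC k1).
  by rewrite linearB linearZ /= scalerN.
- move=> t t0 k b; have -> : (fun s => F s k b) = (fun s => (y s (k, rshift r b))%:C%C).
    by apply/funext => u; rewrite mxE.
  have yd := cderiv_real ((hy (k, rshift r b)).2 t t0).
  suff -> : (F t *m (complex_mx A)^T + complex_mx lap *m F t *m - G^T + 0) k b =
    (linop net (y t) (k, rshift r b))%:C%C by [].
  rewrite linop_network_error addr0 mulmxN rmorphB /= !raddf_sum /=.
  rewrite [LHS]mxE [X in X + _]mxE [X in _ + X]mxE [X in _ - X]mxE.
  rewrite sumrN; congr (_ - _); apply: eq_bigr => c _.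
    by rewrite rmorphM mulrC [F _ _ _]mxE [_^T _ _]mxE [complex_mx _ _ _]mxE.
  rewrite rmorphM mulrC [_^T _ _]mxE [G _ _]mxE; congr (_ * _).
  rewrite mxE raddf_sum; apply: eq_bigr => h _.
  by rewrite /= rmorphM [F _ _ _]mxE [complex_mx _ _ _]mxE.
- by move=> k b; apply: cvanish_eventually0 => t _; rewrite mxE.
- move=> t t0; apply/rowP => b; rewrite DE [RHS]mxE; apply/eqP; rewrite subr_eq0; apply/eqP.
  apply: (laplacian_kernelC hE htree); rewrite mulmxA.
  have := Cayley_Hamilton (complex_mx lap).
  by rewrite chi rmorphM /= horner_mx_X -mulmxE => ->; rewrite mul0mx.
Qed.

(** The difference of two states is driven by the difference of the errors, which
    vanishes, through the Hurwitz matrix [A - B K]. *)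
Lemma state_consensus i j a :
  y t (j, lshift r a) - y t (i, lshift r a) @[t --> +oo] --> (0 : R).
Proof.
pose x t : 'rV[R[i]]_r := \row_b (y t (j, lshift r b) - y t (i, lshift r b))%:C%C.
pose e t : 'rV[R[i]]_r := \row_b (y t (j, rshift r b) - y t (i, rshift r b))%:C%C.
pose g t := e t *m (complex_mx (B *m K))^T.
suff xv : mvanish x.
  apply/cvanish_real; have := xv 0 a; congr cvanish; apply/funext => t.
  by rewrite mxE.
apply: (hurwitz_stable hABK (g := g)).
- move=> t t0 k b; rewrite ord1.
  have -> : (fun s => x s 0 b) =
      (fun s => (y s (j, lshift r b) - y s (i, lshift r b))%:C%C).
    by apply/funext => u; rewrite mxE.
  have dj := (hy (j, lshift r b)).2 t t0.
  have di := (hy (i, lshift r b)).2 t t0.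
  have yd := cderiv_real (is_deriveB dj di).
  suff -> : (x t *m (complex_mx (A - B *m K))^T + g t) 0 b =
    (linop net (y t) (j, lshift r b) - linop net (y t) (i, lshift r b))%:C%C by [].
  rewrite !linop_network_state opprD addrACA -!sumrB rmorphD /= !raddf_sum.
  rewrite [LHS]mxE [X in X + _]mxE [X in _ + X]mxE.
  congr (_ + _); apply: eq_bigr => c _;
    by rewrite -mulrBr /= rmorphM mulrC [_^T _ _]mxE [complex_mx _ _ _]mxE [X in _ * X]mxE.
- apply: mvanish_mulr => k b; under eq_fun do rewrite mxE.
  by apply/cvanish_real; exact: error_consensus.
Qed.
End Design.

Section Necessity.
Hypothesis n2 : (1 <= n)%N.
Hypothesis hcons : forall q i j a,
  flow net (fun k => (k == q)%:R) t (j, a) - flow net (fun k => (k == q)%:R) t (i, a)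
    @[t --> +oo] --> (0 : R).

Lemma mode_eq0 (l : state -> R[i]) (z : R[i]) q :
  (forall a, \sum_i l (i, a) = 0) ->
  (forall t u, (\sum_p l p * (net p u)%:C%C) * (flow net (fun k => (k == q)%:R) t u)%:C%C
     = z * l u * (flow net (fun k => (k == q)%:R) t u)%:C%C) ->
  0 <= complex.Re z -> l q = 0.
Proof.
move=> l0 lz z0.
have := mode_obstruction (flow_solves net _) (hcons q) l0 lz z0.
rewrite (bigD1 q)//= flow0 eqxx mulr1 big1 ?addr0// => k kq.
by rewrite flow0 (negbTE kq) mulr0.
Qed.

(** Release one agent from a basis vector with zero errors: the errors stay [0],
    so that a left eigenvector of [A - B K] applied to the difference of the
    first two agents is a mode of the network. *)
Lemma state_feedback_hurwitz : hurwitz (A - B *m K).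
Proof.
move=> z /eigenvalueP[v vz v0]; rewrite ltNge; apply/negP => z0.
move/negP: v0; apply; apply/eqP/rowP => b; rewrite [RHS]mxE.
pose i1 : 'I_n.+1 := lift ord0 (Ordinal n2).
pose s i : R[i] := (i == ord0)%:R - (i == i1)%:R.
have s0 : \sum_i s i = 0.
  rewrite sumrB (bigD1 ord0)//= big1 => [|i /negbTE -> //].
  rewrite (bigD1 i1)//= [X in _ - (_ + X)]big1 => [|i /negbTE -> //].
  by rewrite ?eqxx ?subrr ?addr0 ?subrr.
pose l (u : state) := s u.1 * (row_mx v 0 : 'rV_(r + r)) 0 u.2.
have ll i a : l (i, lshift r a) = s i * v 0 a by rewrite /l row_mxEl.
have lr i a : l (i, rshift r a) = 0 by rewrite /l row_mxEr mxE mulr0.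
have := mode_eq0 (l := l) (z := z) (q := (ord0, lshift r b)).
rewrite ll /s eqxx subr0 mul1r; apply => //.
- move=> a; case: (split_ordP a) => c ->; last by apply: big1 => i _; rewrite lr.
  by under eq_bigr do rewrite ll; rewrite -mulr_suml s0 mul0r.
- move=> t [i a]; case: (split_ordP a) => c ->; last first.
    (* Zero errors are preserved by every iterate of the network matrix. *)
    rewrite [flow _ _ _ _]flow_eq0 ?mulr0// => k.
    elim: k i c => [|k ih] i c /=; first by rewrite xpair_eqE eq_rlshift andbF.
    rewrite linop_network_error !big1 ?subr0// => h _.
      by rewrite big1 ?mulr0// => g _; rewrite ih mulr0.
    by rewrite ih mulr0.
  congr (_ * _); rewrite ll.
  transitivity (\sum_j \sum_b l (j, b) * (net (j, b) (i, lshift r c))%:C%C).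
    by rewrite pair_bigA; apply: eq_bigr => -[].
  under eq_bigr do rewrite big_split_ord /=.
  rewrite (bigD1 i)//= [X in _ + X]big1 ?addr0 => [|j ji]; last first.
    rewrite !big1 ?addr0// => d _; first by rewrite lr mul0r.
    by rewrite network_state_state (negbTE ji) mul0r mulr0.
  rewrite [X in _ + X]big1 ?addr0 => [|d _]; last by rewrite lr mul0r.
  have /rowP/(_ c) := vz; rewrite [LHS]mxE [RHS]mxE => vc.
  rewrite mulrCA -vc mulr_sumr; apply: eq_bigr => d _.
  rewrite ll -mulrA; congr (_ * (_ * _)).
  by rewrite network_state_state eqxx mul1r [RHS]mxE.
Qed.

(** If [w] is a left eigenvector of the Laplacian for [lam i] and [v] one of
    [A - lam i L C], then [w (x) v], extended by [0] to the states, is a left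
    eigenvector of the network. It annihilates consensus states because [w] is
    orthogonal to the constant vectors: these are in the kernel of the Laplacian,
    while [lam i] is not [0]. *)
Lemma observer_hurwitz (i : 'I_n.+1) : (1 <= i)%N ->
  hurwitzC (complex_mx A - lam i *: complex_mx (L *m C)).
Proof.
move=> i1 z /eigenvalueP[v vz v0]; rewrite ltNge; apply/negP => z0.
have /eigenvalueP[w wl w0] : eigenvalue (complex_mx lap) (lam i).
  have [chi _ _] := hlam.
  by rewrite eigenvalue_root_char /root chi horner_prod (bigD1 i)//= hornerXsubC subrr mul0r.
have ws : \sum_j w 0 j = 0.
  apply: (mulfI (laplacian_eigenvalue_neq0 hE htree hlam i1)).
  rewrite mulr0 mulr_sumr.
  transitivity (\sum_j \sum_k w 0 k * (lap k j)%:C%C).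
    apply: eq_bigr => j _; have /rowP/(_ j) := wl; rewrite [LHS]mxE [RHS]mxE => <-.
    by apply: eq_bigr => k _; rewrite [complex_mx _ _ _]mxE.
  rewrite exchange_big big1// => k _.
  by rewrite -mulr_sumr -rmorph_sum laplacian_row_sum// rmorph0 mulr0.
pose l (u : state) := w 0 u.1 * (row_mx 0 v : 'rV_(r + r)) 0 u.2.
have ll j a : l (j, lshift r a) = 0 by rewrite /l row_mxEl mxE mulr0.
have lr j a : l (j, rshift r a) = w 0 j * v 0 a by rewrite /l row_mxEr.
have [j wj] : exists j, w 0 j != 0 by apply/rV0Pn.
have [a va] : exists a, v 0 a != 0 by apply/rV0Pn.
have : l (j, rshift r a) != 0 by rewrite lr mulf_neq0.
apply/negP; rewrite negbK; apply/eqP; apply: (mode_eq0 (z := z)) => //.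
- by move=> b; rewrite /l /= -mulr_suml ws mul0r.
- move=> t [k b]; congr (_ * _).
  transitivity (\sum_h \sum_c l (h, c) * (net (h, c) (k, b))%:C%C).
    by rewrite pair_bigA; apply: eq_bigr => -[].
  under eq_bigr do rewrite big_split_ord /=.
  under eq_bigr do under eq_bigr do rewrite ll mul0r.
  under eq_bigr do rewrite big1_eq add0r.
  case: (split_ordP b) => c ->.
    rewrite ll mulr0; apply: big1 => h _; apply: big1 => d _.
    by rewrite network_error_state mulr0.
  (* On the errors the network matrix is [I (x) A - L (x) (L C)]; its second term
     factors into the two eigenvector equations. *)
  under eq_bigr do under eq_bigr do
    rewrite lr network_error_error rmorphB /= !rmorphM /= mulrBr.
  have /rowP/(_ k) := wl; have /rowP/(_ c) := vz.
  rewrite [LHS]mxE [RHS]mxE => vc; rewrite [LHS]mxE [RHS]mxE => wk.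
  under eq_bigr do rewrite sumrB; rewrite sumrB lr mulrCA -vc.
  have -> : \sum_h \sum_d w 0 h * v 0 d * ((lap h k)%:C%C * ((L *m C) d c)%:C%C) =
      w 0 k * (\sum_d v 0 d * (lam i *: complex_mx (L *m C)) d c).
    transitivity ((\sum_h w 0 h * (complex_mx lap) h k) *
        (\sum_d v 0 d * complex_mx (L *m C) d c)).
      rewrite big_distrlr; apply: eq_bigr => h _; apply: eq_bigr => d _ /=.
      by rewrite [complex_mx _ _ _]mxE [complex_mx _ _ _]mxE mulrACA.
    rewrite wk [lam i * _]mulrC -mulrA; congr (_ * _); rewrite mulr_sumr.
    by apply: eq_bigr => d _; rewrite [X in _ = _ * X]mxE mulrCA.
  rewrite (bigD1 k)//= [X in _ + X - _]big1 ?addr0 => [|h hk]; last first.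
    by apply: big1 => d _; rewrite (negbTE hk) mul0r mulr0.
  rewrite !mulr_sumr -sumrB; apply: eq_bigr => d _.
  rewrite eqxx mul1r -!mulrA -!mulrBr [X in _ = _ * (_ * X)]mxE.
  by rewrite [complex_mx A _ _]mxE [X in _ = _ * (_ * (_ + X))]mxE.
Qed.

End Necessity.
End Consensus.

(** * Solvability *)

Theorem theorem1 (R : realType) (n r m p : nat) (E : rel 'I_n)
    (A : 'M[R]_r) (B : 'M[R]_(r, m)) (C : 'M[R]_(p, r)) (lam : 'I_n -> R[i])
    (hn : (2 <= n)%N) (hE : irreflexive E) (htree : has_spanning_tree E)
    (hlam : laplacian_spectrum E lam)
    (hA : metzler A) (hB : nonneg_mx B) (hC : nonneg_mx C)
    (hstab : stabilizable A B) (hdet : detectable A C) :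
  PCDMAS_solvable E A B C <->
  exists (K : 'M[R]_(m, r)) (L : 'M[R]_(r, p)),
    [/\ nonneg_mx (B *m K),
        metzler (A - B *m K) /\ hurwitz (A - B *m K),
        nonneg_mx (L *m C),
        metzler (A - lmax R E *: (L *m C))
      & forall i : 'I_n, (1 <= i)%N ->
          hurwitzC (complex_mx A - lam i *: complex_mx (L *m C))].
Proof.
case: n E lam hn hE htree hlam => [//|n'] E' lam' hn' hE' htree' hlam'.
split=> [[K [L design]]|[K [L [BK [ABK hABK] LC ALC hALC]]]]; exists K, L.
(* Every column of the flow of the network is a solution with a non-negative
   initial value; these solutions suffice to recover all conditions. *)
- pose M := network E' A B C K L.
  pose y q := flow M (fun u => (u == q)%:R).
  pose x q i t : 'cV[R]_(r + r) := \col_a y q t (i, a).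
  have xE q : (fun t u => x q u.1 t u.2 0) = y q.
    by apply/funext => t; apply/funext => -[i a]; rewrite mxE.
  have {}design q := design (x q)
    ((closed_loop_solvesE A B C K L hE' (x q)).2
       (eq_ind_r (solves M) (flow_solves M _) (xE q))).
  have x0 q i : nonneg_mx (x q i 0).
    by move=> a b; rewrite mxE /y flow0 ler0n.
  have M0 : forall u v, u != v -> 0 <= M u v.
    apply: flow_ge0_metzler => q t [i a] t0.
    by have := (design q (x0 q)).2 t i t0 a 0; rewrite mxE.
  have cons q i j a : y q t (j, a) - y q t (i, a) @[t --> +oo] --> (0 : R).
    have /cvg_cvP/(_ a) := (design q (x0 q)).1 i j.
    rewrite mxE; apply: cvg_trans; apply: near_eq_cvg.
    by apply: nearW => t; rewrite !mxE.
  have [BK ABK LC ALC] := network_metzler_design hE' hn' htree' hA M0.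
  split=> // [|i i1]; first by split => //; exact: state_feedback_hurwitz hn' cons.
  exact: (observer_hurwitz hE' htree' hlam' cons i1).
- move=> x /(closed_loop_solvesE A B C K L hE' x).1 xM x0; split=> [i j|t i t0 a b].
    apply/cvg_cvP => a; rewrite mxE.
    have -> : (fun t => (x j t - x i t) a 0) = (fun t => x j t a 0 - x i t a 0).
      by apply/funext => t; rewrite !mxE.
    case: (split_ordP a) => a' ->.
      exact: (state_consensus hE' htree' hlam' hABK hALC xM i j a').
    exact: (error_consensus hE' htree' hlam' hALC xM i j a').
  rewrite ord1; have M0 := network_metzler BK ABK LC ALC.
  by apply: (metzler_solves_ge0 M0 xM) t (i, a) t0 => -[k c]; exact: x0.
Qed.
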